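(* Let $A$ be an $n\times n$ real matrix. The TSP-QAP for matrix $A$ is linearizable if and only if $A$ is a weak sum matrix.
   Context: All matrices have real entries, and $S_n$ denotes the set of all permutations of $\{1,\ldots,n\}$. For $n\times n$ matrices $A=(a_{ij})$, $B=(b_{ij})$ and $\pi\in S_n$ put $\mathrm{QAP}(A,B,\pi)=\sum_{i=1}^n\sum_{j=1}^n a_{\pi(i)\pi(j)}\,b_{ij}$. For an $n\times n$ matrix $C=(c_{ij})$ and $\pi\in S_n$ put $\mathrm{LAP}(C,\pi)=\sum_{i=1}^n c_{i\pi(i)}$. The QAP with matrices $A$ and $B$ is called linearizable if there exists an $n\times n$ matrix $C$ such that $\mathrm{QAP}(A,B,\pi)=\mathrm{LAP}(C,\pi)$ for all $\pi\in S_n$ (all permutations, not just the cyclic ones). Let $H_n=(h_{ij})$ be the $n\times n$ matrix with $h_{ij}=1$ if $j=i+1$, or if $i=n$ and $j=1$, and $h_{ij}=0$ otherwise (the adjacency matrix of a directed Hamiltonian cycle). The TSP-QAP for an $n\times n$ matrix $A$ is the QAP with first matrix $A$ and second matrix $B=H_n$. An $n\times n$ matrix $A=(a_{ij})$ is a sum matrix if there exist real numbers $\alpha_1,\ldots,\alpha_n$ and $\beta_1,\ldots,\beta_n$ with $a_{ij}=\alpha_i+\beta_j$ for all $1\le i,j\le n$. $A$ is a weak sum matrix if it can be turned into a sum matrix by appropriately changing the entries on its main diagonal. *)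

(* Defs.v *)
From mathcomp Require Import all_boot all_order all_fingroup all_algebra.
From mathcomp Require Import reals.

Set Implicit Arguments.
Unset Strict Implicit.
Unset Printing Implicit Defensive.

Import GRing.Theory.
Local Open Scope ring_scope.

(* The index set {1, ..., n} is rendered by 'I_n = {0, ..., n-1}. *)

Definition QAP (R : realType) (n : nat) (A B : 'M[R]_n) (pi : 'S_n) : R :=
  \sum_(i < n) \sum_(j < n) A (pi i) (pi j) * B i j.

Definition LAP (R : realType) (n : nat) (C : 'M[R]_n) (pi : 'S_n) : R :=
  \sum_(i < n) C i (pi i).

Definition linearizable (R : realType) (n : nat) (A B : 'M[R]_n) : Prop :=
  exists C : 'M[R]_n, forall pi : 'S_n, QAP A B pi = LAP C pi.

(* For n = 1 the matrix is a single loop, as the defining formula gives. *)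
Definition hamcycle_mx (R : realType) (n : nat) : 'M[R]_n :=
  \matrix_(i < n, j < n)
    if (j == i.+1 :> nat) || ((i.+1 == n) && (j == 0%N :> nat)) then 1 else 0.

Definition tsp_qap_linearizable (R : realType) (n : nat) (A : 'M[R]_n) : Prop :=
  linearizable A (hamcycle_mx R n).

Definition sum_matrix (R : realType) (n : nat) (A : 'M[R]_n) : Prop :=
  exists alpha beta : 'I_n -> R, forall i j : 'I_n, A i j = alpha i + beta j.

Definition weak_sum_matrix (R : realType) (n : nat) (A : 'M[R]_n) : Prop :=
  exists A' : 'M[R]_n,
    sum_matrix A' /\ forall i j : 'I_n, i != j -> A' i j = A i j.

(* Main.v *)
Require Import Defs.
From mathcomp Require Import all_boot all_order all_fingroup all_algebra.
From mathcomp Require Import reals.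
From mathcomp Require Import lra.

Set Implicit Arguments.
Unset Strict Implicit.
Unset Printing Implicit Defensive.

Import GRing.Theory Num.Theory.
Local Open Scope ring_scope.

(** QAP (A, H_n, pi) is the length of the closed tour pi 0, pi 1, ..., so it
    does not change when the tour is rotated. Summing LAP (C, .) over all
    rotations of pi gives the sum of all entries of C, which does not depend
    on pi. A linearizable TSP-QAP is therefore a constant one
    (linearizable_tour_length_const), and the question becomes which distance
    matrices give all tours the same length.

    If all tours have the same length, exchanging two consecutive vertices of
    a tour costs nothing: the paths x u v y and x v u y are equally long for
    all distinct x, u, v, y, and on three vertices also for y = x. These local
    identities already force the weak sum property
    (swap_neutral_weak_sum): after subtracting a sum matrix that clears the
    row and the column of one vertex o, they say that all other off-diagonal
    entries coincide, and such a matrix is a weak sum matrix.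

    Conversely, if A agrees with alpha_i + beta_j off the diagonal, then every
    tour on at least two vertices leaves and enters each vertex once and has
    length sum alpha + sum beta; the matrix alpha_j + beta_j has that LAP
    value on every permutation. *)

(** * Tour lengths *)

(** Positions are read in the cyclic group Z/(n+1)Z carried by 'I_n.+1, so that
    the successor along the Hamiltonian cycle is addition of Zp1. *)
Definition tour_length (R : realType) (n : nat) (A : 'M[R]_n.+1)
    (pi : 'S_n.+1) : R :=
  \sum_(i < n.+1) A (pi i) (pi (i + Zp1)).

Lemma hamcycle_mxE (R : realType) (n : nat) (i j : 'I_n.+1) :
  hamcycle_mx R n.+1 i j = (j == i + Zp1)%:R.
Proof.
have -> : (j == i + Zp1) =
    (j == i.+1 :> nat) || ((i.+1 == n.+1) && (j == 0%N :> nat)).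
  rewrite -val_eqE /= modnDmr addn1.
  have := ltn_ord i; rewrite leq_eqVlt => /orP[/eqP ei | lt_i_n].
    by rewrite ei modnn eqxx /= (ltn_eqF (ltn_ord j)).
  by rewrite modn_small // (ltn_eqF lt_i_n) /= orbF.
by rewrite mxE; case: ifP.
Qed.

Lemma QAP_hamcycle (R : realType) (n : nat) (A : 'M[R]_n.+1) (pi : 'S_n.+1) :
  QAP A (hamcycle_mx R n.+1) pi = tour_length A pi.
Proof.
apply: eq_bigr => i _; rewrite (bigD1 (i + Zp1)) //= big1 => [|j ne_j].
  by rewrite addr0 hamcycle_mxE eqxx mulr1.
by rewrite hamcycle_mxE (negPf ne_j) mulr0.
Qed.

Lemma tour_length_rotate (R : realType) (n : nat) (A : 'M[R]_n.+1)
    (pi : 'S_n.+1) (k : 'I_n.+1) :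
  tour_length A (perm (addIr k) * pi) = tour_length A pi.
Proof.
rewrite /tour_length [RHS](reindex_inj (addIr k)); apply: eq_bigr => i _.
by rewrite !permM !permE addrAC.
Qed.

(** A tour has n+1 rotations, all of the same length, and in them every vertex
    occupies every position exactly once; hence the values of LAP on them add
    up to the sum of all entries of C, whatever the tour. *)
Lemma linearizable_tour_length_const (R : realType) (n : nat)
    (A : 'M[R]_n.+1) :
  tsp_qap_linearizable A ->
  forall pi sigma : 'S_n.+1, tour_length A pi = tour_length A sigma.
Proof.
case=> C linC.
have total pi : tour_length A pi *+ n.+1 = \sum_i \sum_j C i j.
  have -> : tour_length A pi *+ n.+1
          = \sum_(k < n.+1) tour_length A (perm (addIr k) * pi).
    under eq_bigr => k _ do rewrite tour_length_rotate.
    by rewrite sumr_const card_ord.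
  under eq_bigr => k _ do rewrite -QAP_hamcycle linC /LAP.
  rewrite exchange_big; apply: eq_bigr => i _ /=.
  rewrite [RHS](reindex_inj (@perm_inj _ pi)) [RHS](reindex_inj (addrI i)) /=.
  by apply: eq_bigr => k _; rewrite permM permE.
move=> pi sigma.
have := total pi; rewrite -(total sigma) => /(pmulrnI (ltn0Sn n)); exact.
Qed.

(** * Exchanging two consecutive vertices of a tour *)

Definition swap_neutral (R : realType) (n : nat) (A : 'I_n -> 'I_n -> R)
    (x u v y : 'I_n) : Prop :=
  A x u + A u v + A v y = A x v + A v u + A u y.

(** Swapping the vertices at positions 1 and 2 only affects the arcs leaving
    positions 0, 1 and 2. On three vertices position 3 is position 0. *)
Lemma tour_length_const_swap (R : realType) (n : nat) (A : 'M[R]_n.+3)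
    (pi : 'S_n.+3) :
  (forall pi sigma : 'S_n.+3, tour_length A pi = tour_length A sigma) ->
  swap_neutral A (pi 0) (pi Zp1) (pi (Zp1 + Zp1)) (pi (Zp1 + Zp1 + Zp1)).
Proof.
move=> constA.
pose p1 : 'I_n.+3 := Zp1; pose p2 := p1 + Zp1; pose p3 := p2 + Zp1.
have p1_neq0 : p1 != 0 by [].
have p2_neq0 : p2 != 0 by [].
have p2_neq1 : p2 != p1 by [].
have p3_neq1 : p3 != p1.
  by rewrite /p3 /p2 -addrA -[X in _ != X]addr0 (inj_eq (addrI p1)).
have p3_neq2 : p3 != p2.
  by rewrite /p3 -[X in _ != X]addr0 (inj_eq (addrI p2)).
have split012 (F : 'I_n.+3 -> R) :
    \sum_i F i =
    F 0 + (F p1 + (F p2 + \sum_(i | (i != 0) && (i != p1) && (i != p2)) F i)).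
  by rewrite (bigD1 (0 : 'I_n.+3)) // (bigD1 p1) //= (bigD1 p2).
have := constA pi (tperm p1 p2 * pi)%g; rewrite /tour_length !split012.
rewrite [in X in _ = X -> _]
  (eq_bigr (fun i => A (pi i) (pi (i + Zp1)))); last first.
  move=> i /andP[/andP[i_neq0 i_neq1] i_neq2].
  rewrite !permM !tpermD // eq_sym //.
    by rewrite -[p1]add0r (inj_eq (addIr Zp1)).
  by rewrite (inj_eq (addIr Zp1)).
rewrite !permM add0r -/p1 -/p2 -/p3 tpermL tpermR.
rewrite [tperm p1 p2 0]tpermD // [tperm p1 p2 p3]tpermD 1?eq_sym //.
rewrite !addrA => /addIr; exact.
Qed.

(** The remaining positions are filled with the vertices missing from s; this
    gives a tour through any prescribed path. *)
Lemma perm_extend_seq (n : nat) (x0 : 'I_n) (s : seq 'I_n) :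
  uniq s ->
  exists pi : 'S_n, forall i : 'I_n, (i < size s)%N -> pi i = nth x0 s i.
Proof.
move=> uniq_s; pose t := s ++ filter [predC s] (enum 'I_n).
have uniq_t : uniq t.
  rewrite cat_uniq uniq_s filter_uniq ?enum_uniq // andbT.
  by apply/hasPn => x; rewrite mem_filter => /andP[].
have size_t : size t = n.
  rewrite -(card_uniqP uniq_t) -[RHS]card_ord; apply: eq_card => x.
  by rewrite mem_cat mem_filter mem_enum /= andbT orbN.
have nth_inj : injective (fun i : 'I_n => nth x0 t i).
  move=> i j /eqP; rewrite nth_uniq ?size_t ?ltn_ord // => /eqP; exact: val_inj.
by exists (perm nth_inj) => i lt_i; rewrite permE nth_cat lt_i.
Qed.

Lemma tour_length_const_swap4 (R : realType) (n : nat) (A : 'M[R]_n.+1) :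
  (forall pi sigma : 'S_n.+1, tour_length A pi = tour_length A sigma) ->
  forall x u v y, uniq [:: x; u; v; y] -> swap_neutral A x u v y.
Proof.
case: n A => [|[|[|n]]] A constA x u v y uniq_s;
  try by have := uniq_leq_size uniq_s (fun z _ => mem_enum 'I__ z);
         rewrite size_enum_ord.
have [pi pi_s] := perm_extend_seq x uniq_s.
have := tour_length_const_swap pi constA.
by rewrite !pi_s /= ?modn_small.
Qed.

Lemma tour_length_const_swap3 (R : realType) (A : 'M[R]_3) :
  (forall pi sigma : 'S_3, tour_length A pi = tour_length A sigma) ->
  forall x u v, uniq [:: x; u; v] -> swap_neutral A x u v x.
Proof.
move=> constA x u v uniq_s; have [pi pi_s] := perm_extend_seq x uniq_s.
by have := tour_length_const_swap pi constA; rewrite !pi_s.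
Qed.

(** * From swap neutrality to weak sum matrices *)

(** A sum matrix satisfies all the swap identities, so a sum matrix may be
    subtracted from A to make row o and column o vanish off the diagonal; call
    the result B. Exchanging o and v in the path u o v y gives B u v = B v y,
    and with it the path o u v y gives B u v = B v u; hence B u v = B y v for
    all y, and moving one index at a time shows that all entries off the
    diagonal and off row and column o are equal. On three vertices only the
    symmetry B u v = B v u is needed, and the closed path o u v o provides it.
*)
Lemma swap_neutral_weak_sum (R : realType) (n : nat) (A : 'M[R]_n.+1) :
  (forall x u v y, uniq [:: x; u; v; y] -> swap_neutral A x u v y) ->
  (n = 2%N -> forall x u v, uniq [:: x; u; v] -> swap_neutral A x u v x) ->
  weak_sum_matrix A.
Proof.
move=> swap4 swap3; pose o : 'I_n.+1 := ord0.
pose s x := if x == o then 0 else A x o.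
pose t y := if y == o then 0 else A o y.
pose B x y := A x y - s x - t y.
have Bo x : x != o -> B x o = 0.
  by move=> /negPf x_o; rewrite /B /s /t x_o eqxx; lra.
have oB y : y != o -> B o y = 0.
  by move=> /negPf y_o; rewrite /B /s /t y_o eqxx; lra.
have swapB x u v y : swap_neutral A x u v y -> swap_neutral B x u v y.
  by rewrite /swap_neutral /B => ?; lra.
have swapB4 x u v y : uniq [:: x; u; v; y] -> swap_neutral B x u v y.
  by move/swap4/swapB.
have shift u v y : uniq [:: o; u; v; y] -> B u v = B v y.
  move=> uniq_s; have uniq_path : uniq [:: u; o; v; y].
    by rewrite -(perm_uniq (_ : perm_eq [:: o; u; v; y] _)) //
      (perm_catCA [:: o] [:: u]).
  move: uniq_s => /=; rewrite !inE !negb_or ![o == _]eq_sym.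
  move=> /andP[/and3P[uo vo yo] _]; have := swapB4 u o v y uniq_path.
  by rewrite /swap_neutral !Bo // !oB // !add0r !addr0 => ->.
have sym u v : u != o -> v != o -> u != v -> B u v = B v u.
  move=> uo vo uv; have uniq_ouv : uniq [:: o; u; v].
    by rewrite /= !inE negb_or ![o == _]eq_sym uo vo uv.
  have [y y_new | no_other] := pickP [predC [:: o; u; v]].
    have {}y_new : y \notin [:: o; u; v] := y_new.
    have uniq_ouvy : uniq [:: o; u; v; y].
      by rewrite -[[:: _; _; _; y]]/(rcons [:: o; u; v] y) rcons_uniq y_new.
    have uniq_ovuy : uniq [:: o; v; u; y].
      by rewrite -(perm_uniq (_ : perm_eq [:: o; u; v; y] _)) // perm_cons
        (perm_catCA [:: u] [:: v]).
    have := swapB4 o u v y uniq_ouvy.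
    rewrite /swap_neutral !oB // -(shift u v y) // -(shift v u y) // => ?; lra.
  have n2 : n = 2%N.
    apply/succn_inj; rewrite -[LHS]card_ord -[RHS](card_uniqP uniq_ouv).
    by apply: eq_card => x; have /= /negbFE -> := no_other x.
  have := swapB _ _ _ _ (swap3 n2 o u v uniq_ouv).
  by rewrite /swap_neutral !oB // !Bo // !add0r !addr0.
have same_col x y v : x != o -> y != o -> v != o -> x != v -> y != v ->
    B x v = B y v.
  move=> xo yo vo xv yv; have [-> // | xy] := eqVneq x y.
  rewrite (sym y v) //; apply: shift.
  rewrite /= !inE !negb_or (eq_sym o x) (eq_sym o v) (eq_sym o y) (eq_sym v y).
  by rewrite xo vo yo xv xy yv.
have const p q u v : p != o -> q != o -> p != q -> u != o -> v != o -> u != v ->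
    B u v = B p q.
  move=> po qo pq uo vo uv; have qp : q != p by rewrite eq_sym.
  have [vp | vp] := eqVneq v p.
    by rewrite vp in uv *; rewrite (sym p q) //; exact: same_col.
  have pv : p != v by rewrite eq_sym.
  by rewrite (same_col u p v) // (sym p v) // (same_col v q p) // (sym q p).
(* With at most two vertices no entry of B is constrained and any c will do. *)
have [c Bc] : exists c, forall x y, x != o -> y != o -> x != y -> B x y = c.
  have [[p q] /and3P[/= po qo pq] | none] :=
    pickP [pred e : 'I_n.+1 * 'I_n.+1 | [&& e.1 != o, e.2 != o & e.1 != e.2]].
    by exists (B p q) => x y *; apply: const.
  by exists 0 => x y xo yo xy; have := none (x, y); rewrite /= xo yo xy.
(* Since row and column o of B vanish off the diagonal, the constant c is put
   on every row but o and cancelled in column o; entry (o, o) is free. *)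
pose alpha x := s x + (if x == o then 0 else c).
pose beta y := t y - (if y == o then c else 0).
exists (\matrix_(x, y) (alpha x + beta y)); split.
  by exists alpha, beta => x y; rewrite mxE.
move=> x y xy; rewrite mxE.
have -> : A x y = s x + t y + B x y by rewrite /B; lra.
rewrite /alpha /beta; case: (eqVneq x o) => [xo | xo]; last first.
  by have [yo | yo] := eqVneq y o; [rewrite yo Bo // | rewrite Bc //]; lra.
have yo : y != o by rewrite eq_sym -xo.
by rewrite xo (negPf yo) oB //; lra.
Qed.

(** The entry of C depends only on the vertex, not on its position, so that
    LAP C is the constant sum alpha + sum beta. At least two vertices are
    needed for the tour to avoid the diagonal of A. *)
Lemma weak_sum_tsp_qap_linearizable (R : realType) (n : nat)
    (A : 'M[R]_n.+2) :
  weak_sum_matrix A -> tsp_qap_linearizable A.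
Proof.
case=> A' [[alpha [beta A'E]] A'A].
exists (\matrix_(i, j) (alpha j + beta j)) => pi.
rewrite QAP_hamcycle /tour_length /LAP.
under [RHS]eq_bigr do rewrite mxE; rewrite big_split /=.
rewrite [X in _ = _ + X](reindex_inj (addIr Zp1)) -big_split /=.
apply: eq_bigr => i _; rewrite -A'A ?A'E // (inj_eq perm_inj).
by rewrite -[X in X == _]addr0 (inj_eq (addrI i)).
Qed.

Theorem theorem5p2 (R : realType) (n : nat) (A : 'M[R]_n) :
  tsp_qap_linearizable A <-> weak_sum_matrix A.
Proof.
case: n A => [|n] A.
  split=> _; last by exists 0 => pi; rewrite /QAP /LAP !big_ord0.
  by exists 0; split=> [|[]//]; exists (fun=> 0), (fun=> 0) => [[]].
split=> [linA | wsA].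
  have constA := linearizable_tour_length_const linA.
  apply: swap_neutral_weak_sum; first exact: tour_length_const_swap4.
  move=> n2; move: A {linA} constA; rewrite n2.
  exact: tour_length_const_swap3.
case: n A wsA => [|n] A wsA; last exact: weak_sum_tsp_qap_linearizable.
(* The only tour on one vertex is the loop. *)
exists A => pi; rewrite QAP_hamcycle; apply: eq_bigr => i _.
by congr (A _ _); rewrite !ord1.
Qed.
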